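(* Let $J\colon\mathcal A\to\mathcal E$ be a pseudofunctor between bicategories and let $T$ be a $J$-relative pseudomonad. Let $\ell\dashv r$ be a coreflective adjunction in $\mathcal E$, with $\ell\colon A\to B$, $r\colon B\to A$, unit $\nu\colon1_A\Rightarrow r\ell$ (which is invertible) and counit $\varepsilon\colon\ell r\Rightarrow1_B$, and let $(B,(-)^b,\hat b,\tilde b)$ be a $T$-pseudoalgebra. If the 2-cell $$r(\ell rf)^b\xrightarrow{\;r(\varepsilon f)^b\;}rf^b$$ is invertible for every $X\in\mathcal A$ and $f\colon JX\to B$, then: (1) $A$ acquires a $T$-pseudoalgebra structure; (2) $r$ acquires the structure of a pseudomorphism of $T$-pseudoalgebras and $\ell$ acquires the structure of a colax morphism of $T$-pseudoalgebras; (3) the unit $\nu$ and counit $\varepsilon$ are transformations. Hence, the adjunction $\ell\dashv r$ lifts to an adjunction in $\mathrm{PsAlg}_c(T)$. In particular, if $\ell\dashv r$ is an adjoint equivalence then it lifts to $\mathrm{PsAlg}(T)$. Conversely, if $\ell\dashv r$ lifts to an adjunction in $\mathrm{PsAlg}_c(T)$ (for some $T$-pseudoalgebra structure on $A$ and the given one on $B$) then the 2-cell displayed above is invertible for every $f\colon JX\to B$ in $\mathcal E$.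
   Context: Conventions. For a bicategory $\mathcal E$, $\mathcal E[X,Y]$ is the hom-category; composition of 1-cells and whiskering are written by juxtaposition, vertical composition of 2-cells by $\circ$; structural isomorphisms (associators, unitors, pseudofunctor constraints) are left implicit in equations or written $\cong$. A $J$-relative pseudomonad $T$ comprises: an object $TX\in\mathcal E$ for each $X\in\mathcal A$; functors $(-)^*\colon\mathcal E[JX,TY]\to\mathcal E[TX,TY]$ for $X,Y\in\mathcal A$; 1-cells $i_X\colon JX\to TX$; invertible 2-cells $\mu_{g,f}\colon(g^*f)^*\Rightarrow g^*f^*$ natural in $f\colon JX\to TY$, $g\colon JY\to TZ$; invertible 2-cells $\eta_f\colon f\Rightarrow f^*i_X$ natural in $f\colon JX\to TY$; invertible 2-cells $\theta_X\colon(i_X)^*\Rightarrow 1_{TX}$; such that $(\mu_{h,g}f^* )\circ\mu_{h^*g,f}=(h^*\mu_{g,f})\circ\mu_{h,g^*f}\circ(\mu_{h,g}f)^*$ for all $f\colon JW\to TX$, $g\colon JX\to TY$, $h\colon JY\to TZ$, and $(f^*\theta_X)\circ\mu_{f,i_X}\circ(\eta_f)^*$ is the structural isomorphism $f^*\cong f^*1_{TX}$ for all $f\colon JX\to TY$. A $T$-pseudoalgebra $(A,(-)^a,\hat a,\tilde a)$ comprises: an object $A\in\mathcal E$; functors $(-)^a\colon\mathcal E[JX,A]\to\mathcal E[TX,A]$ for $X\in\mathcal A$; invertible 2-cells $\hat a_{g,f}\colon(g^af)^a\Rightarrow g^af^*$ natural in $f\colon JX\to TY$, $g\colon JY\to A$;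 invertible 2-cells $\tilde a_f\colon f\Rightarrow f^ai_X$ natural in $f\colon JX\to A$; such that $(\hat a_{h,g}f^* )\circ\hat a_{h^ag,f}=(h^a\mu_{g,f})\circ\hat a_{h,g^*f}\circ(\hat a_{h,g}f)^a$ for all $f\colon JX\to TY$, $g\colon JY\to TZ$, $h\colon JZ\to A$, and $(f^a\theta_X)\circ\hat a_{f,i_X}\circ(\tilde a_f)^a$ is the structural isomorphism $f^a\cong f^a1_{TX}$ for all $f\colon JX\to A$. A colax morphism $(h,\overline h)\colon(A,(-)^a,\hat a,\tilde a)\to(B,(-)^b,\hat b,\tilde b)$ comprises a 1-cell $h\colon A\to B$ and 2-cells $\overline h_f\colon hf^a\Rightarrow(hf)^b$ natural in $f\colon JX\to A$ such that $\hat b_{hg,f}\circ(\overline h_gf)^b\circ\overline h_{g^af}=(\overline h_gf^* )\circ(h\hat a_{g,f})$ for all $f\colon JX\to TY$, $g\colon JY\to A$, and $(\overline h_fi_X)\circ(h\tilde a_f)=\tilde b_{hf}$ for all $f\colon JX\to A$. A pseudomorphism is (up to inverting the 2-cells, so that $\overline h_f\colon(hf)^b\Rightarrow hf^a$) a colax morphism with every $\overline h_f$ invertible. A transformation of colax morphisms is a 2-cell $\alpha\colon h\Rightarrow h'$ with $(\alpha f)^b\circ\overline h_f=\overline{h'}_f\circ(\alpha f^a)$ for all $f\colon JX\to A$. $\mathrm{PsAlg}_c(T)$ (resp. $\mathrm{PsAlg}(T)$) is the bicategory of $T$-pseudoalgebras, colax morphisms (resp. pseudomorphisms) and transformations; the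 composite of $(h,\overline h)\colon A\to B$ and $(h',\overline{h'})\colon B\to C$ is $h'h$ with $(h'h)f^a\cong h'(hf^a)\xrightarrow{h'\overline h_f}h'(hf)^b\xrightarrow{\overline{h'}_{hf}}(h'(hf))^c\cong((h'h)f)^c$, identities are $1_A$ with the structural isomorphisms, and the rest is as in $\mathcal E$. An adjunction in $\mathcal E$ lifts to $\mathrm{PsAlg}_c(T)$ (or $\mathrm{PsAlg}(T)$) if its 1-cells acquire colax (or pseudo) morphism structures for which the unit and counit are transformations. *)

(* Defs.v *)
From Stdlib Require Import ssreflect ProofIrrelevance.

Set Implicit Arguments.
Unset Strict Implicit.
Unset Printing Implicit Defensive.

Declare Scope bicat_scope.
Delimit Scope bicat_scope with bicat.
Local Open Scope bicat_scope.

Reserved Notation "x ⟹ y" (at level 70, no associativity).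
Reserved Notation "β ∘ α" (at level 40, left associativity).
Reserved Notation "g · f" (at level 35, right associativity).
Reserved Notation "h ◁ α" (at level 36, no associativity).
Reserved Notation "α ▷ f" (at level 36, no associativity).

Record Category := {
  obj :> Type;
  Hom : obj -> obj -> Type;
  idm : forall x, Hom x x;
  vcomp : forall x y z, Hom y z -> Hom x y -> Hom x z;
  vcomp_idl : forall x y (f : Hom x y), vcomp (idm y) f = f;
  vcomp_idr : forall x y (f : Hom x y), vcomp f (idm x) = f;
  vcompA : forall w x y z (h : Hom y z) (g : Hom x y) (f : Hom w x),
    vcomp h (vcomp g f) = vcomp (vcomp h g) f
}.
Arguments Hom {_} x y.
Arguments idm {_} x.

Notation "x ⟹ y" := (Hom x y) : bicat_scope.
Notation "β ∘ α" := (vcomp β α) : bicat_scope.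

Record Iso (C : Category) (x y : C) := {
  fwd :> x ⟹ y;
  bwd : y ⟹ x;
  bwdK : bwd ∘ fwd = idm x;
  fwdK : fwd ∘ bwd = idm y
}.
Arguments Iso {C} x y.

Definition is_iso (C : Category) (x y : C) (f : x ⟹ y) : Prop :=
  exists g : y ⟹ x, g ∘ f = idm x /\ f ∘ g = idm y.

Record Functor (C D : Category) := {
  fobj :> C -> D;
  fmap : forall x y : C, x ⟹ y -> fobj x ⟹ fobj y;
  fmap_id : forall x, fmap (idm x) = idm (fobj x);
  fmap_comp : forall (x y z : C) (g : y ⟹ z) (f : x ⟹ y),
    fmap (g ∘ f) = fmap g ∘ fmap f
}.
Arguments fmap {C D} _ {x y} _.

(* Horizontal composition is given by its two whiskerings. *)
Record Bicategory := {
  cell0 :> Type;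
  homcat : cell0 -> cell0 -> Category;
  id1 : forall X, homcat X X;
  comp1 : forall X Y Z, homcat Y Z -> homcat X Y -> homcat X Z;
  lwhisker : forall X Y Z (h : homcat Y Z) (f g : homcat X Y),
    f ⟹ g -> comp1 h f ⟹ comp1 h g;
  rwhisker : forall X Y Z (g h : homcat Y Z),
    g ⟹ h -> forall f : homcat X Y, comp1 g f ⟹ comp1 h f;
  assoc : forall W X Y Z (h : homcat Y Z) (g : homcat X Y) (f : homcat W X),
    Iso (comp1 (comp1 h g) f) (comp1 h (comp1 g f));
  lunit : forall X Y (f : homcat X Y), Iso (comp1 (id1 Y) f) f;
  runit : forall X Y (f : homcat X Y), Iso (comp1 f (id1 X)) f;
  lwhisker_id : forall X Y Z (h : homcat Y Z) (f : homcat X Y),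
    lwhisker h (idm f) = idm (comp1 h f);
  lwhisker_comp : forall X Y Z (h : homcat Y Z) (f g k : homcat X Y)
      (β : g ⟹ k) (α : f ⟹ g),
    lwhisker h (β ∘ α) = lwhisker h β ∘ lwhisker h α;
  rwhisker_id : forall X Y Z (h : homcat Y Z) (f : homcat X Y),
    rwhisker (idm h) f = idm (comp1 h f);
  rwhisker_comp : forall X Y Z (f g k : homcat Y Z)
      (β : g ⟹ k) (α : f ⟹ g) (e : homcat X Y),
    rwhisker (β ∘ α) e = rwhisker β e ∘ rwhisker α e;
  interchange : forall X Y Z (g g' : homcat Y Z) (f f' : homcat X Y)
      (β : g ⟹ g') (α : f ⟹ f'),
    rwhisker β f' ∘ lwhisker g α = lwhisker g' α ∘ rwhisker β f;
  lunit_nat : forall X Y (f g : homcat X Y) (α : f ⟹ g),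
    lunit g ∘ lwhisker (id1 Y) α = α ∘ lunit f;
  runit_nat : forall X Y (f g : homcat X Y) (α : f ⟹ g),
    runit g ∘ rwhisker α (id1 X) = α ∘ runit f;
  assoc_nat_r : forall W X Y Z (h : homcat Y Z) (g : homcat X Y)
      (f f' : homcat W X) (α : f ⟹ f'),
    assoc h g f' ∘ lwhisker (comp1 h g) α
      = lwhisker h (lwhisker g α) ∘ assoc h g f;
  assoc_nat_m : forall W X Y Z (h : homcat Y Z) (g g' : homcat X Y)
      (f : homcat W X) (α : g ⟹ g'),
    assoc h g' f ∘ rwhisker (lwhisker h α) f
      = lwhisker h (rwhisker α f) ∘ assoc h g f;
  assoc_nat_l : forall W X Y Z (h h' : homcat Y Z) (g : homcat X Y)
      (f : homcat W X) (α : h ⟹ h'),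
    assoc h' g f ∘ rwhisker (rwhisker α g) f
      = rwhisker α (comp1 g f) ∘ assoc h g f;
  pentagon : forall V W X Y Z (k : homcat Y Z) (h : homcat X Y)
      (g : homcat W X) (f : homcat V W),
    assoc k h (comp1 g f) ∘ assoc (comp1 k h) g f
      = lwhisker k (assoc h g f) ∘ assoc k (comp1 h g) f
        ∘ rwhisker (assoc k h g) f;
  triangle : forall X Y Z (g : homcat Y Z) (f : homcat X Y),
    lwhisker g (lunit f) ∘ assoc g (id1 Y) f = rwhisker (runit g) f
}.
Coercion homcat : Bicategory >-> Funclass.
Arguments id1 {_} X.
Arguments lwhisker {_ X Y Z} h {f g} _.
Arguments rwhisker {_ X Y Z g h} _ f.
Arguments assoc {_ W X Y Z} h g f.
Arguments lunit {_ X Y} f.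
Arguments runit {_ X Y} f.

Notation "g · f" := (comp1 g f) : bicat_scope.
Notation "h ◁ α" := (lwhisker h α) : bicat_scope.
Notation "α ▷ f" := (rwhisker α f) : bicat_scope.

Record Pseudofunctor (A E : Bicategory) := {
  pobj :> A -> E;
  pmap : forall X Y, Functor (A X Y) (E (pobj X) (pobj Y));
  pcomp : forall X Y Z (g : A Y Z) (f : A X Y),
    Iso (pmap Y Z g · pmap X Y f) (pmap X Z (g · f));
  pid : forall X, Iso (id1 (pobj X)) (pmap X X (id1 X));
  pcomp_nat_r : forall X Y Z (g : A Y Z) (f f' : A X Y) (α : f ⟹ f'),
    pcomp g f' ∘ (pmap Y Z g ◁ fmap (pmap X Y) α)
      = fmap (pmap X Z) (g ◁ α) ∘ pcomp g f;
  pcomp_nat_l : forall X Y Z (g g' : A Y Z) (f : A X Y) (β : g ⟹ g'),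
    pcomp g' f ∘ (fmap (pmap Y Z) β ▷ pmap X Y f)
      = fmap (pmap X Z) (β ▷ f) ∘ pcomp g f;
  passoc : forall W X Y Z (h : A Y Z) (g : A X Y) (f : A W X),
    fmap (pmap W Z) (assoc h g f) ∘ pcomp (h · g) f
        ∘ (pcomp h g ▷ pmap W X f)
      = pcomp h (g · f) ∘ (pmap Y Z h ◁ pcomp g f)
        ∘ assoc (pmap Y Z h) (pmap X Y g) (pmap W X f);
  plunit : forall X Y (f : A X Y),
    fmap (pmap X Y) (lunit f) ∘ pcomp (id1 Y) f ∘ (pid Y ▷ pmap X Y f)
      = lunit (pmap X Y f);
  prunit : forall X Y (f : A X Y),
    fmap (pmap X Y) (runit f) ∘ pcomp f (id1 X) ∘ (pmap X Y f ◁ pid X)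
      = runit (pmap X Y f)
}.

Record IsAdjunction (E : Bicategory) (A B : E) (l : E A B) (r : E B A)
    (ν : id1 A ⟹ r · l) (ε : l · r ⟹ id1 B) : Prop := {
  adj_triangle_l :
    lunit l ∘ (ε ▷ l) ∘ bwd (assoc l r l) ∘ (l ◁ ν) ∘ bwd (runit l) = idm l;
  adj_triangle_r :
    runit r ∘ (r ◁ ε) ∘ assoc r l r ∘ (ν ▷ r) ∘ bwd (lunit r) = idm r
}.

(* [ext f] is the extension [f^*]. Associators and unitors, implicit on paper,
   are written out in the axioms. *)
Record RelPseudomonad (A E : Bicategory) (J : Pseudofunctor A E) := {
  Tobj :> A -> E;
  ext : forall X Y, Functor (E (J X) (Tobj Y)) (E (Tobj X) (Tobj Y));
  Ti : forall X, E (J X) (Tobj X);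
  Tmu : forall X Y Z (g : E (J Y) (Tobj Z)) (f : E (J X) (Tobj Y)),
    ext X Z (ext Y Z g · f) ⟹ ext Y Z g · ext X Y f;
  Teta : forall X Y (f : E (J X) (Tobj Y)), f ⟹ ext X Y f · Ti X;
  Ttheta : forall X, ext X X (Ti X) ⟹ id1 (Tobj X);
  Tmu_iso : forall X Y Z (g : E (J Y) (Tobj Z)) (f : E (J X) (Tobj Y)),
    is_iso (Tmu g f);
  Teta_iso : forall X Y (f : E (J X) (Tobj Y)), is_iso (Teta f);
  Ttheta_iso : forall X, is_iso (Ttheta X);
  Tmu_nat_r : forall X Y Z (g : E (J Y) (Tobj Z)) (f f' : E (J X) (Tobj Y))
      (α : f ⟹ f'),
    Tmu g f' ∘ fmap (ext X Z) (ext Y Z g ◁ α)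
      = (ext Y Z g ◁ fmap (ext X Y) α) ∘ Tmu g f;
  Tmu_nat_l : forall X Y Z (g g' : E (J Y) (Tobj Z)) (f : E (J X) (Tobj Y))
      (β : g ⟹ g'),
    Tmu g' f ∘ fmap (ext X Z) (fmap (ext Y Z) β ▷ f)
      = (fmap (ext Y Z) β ▷ ext X Y f) ∘ Tmu g f;
  Teta_nat : forall X Y (f f' : E (J X) (Tobj Y)) (α : f ⟹ f'),
    Teta f' ∘ α = (fmap (ext X Y) α ▷ Ti X) ∘ Teta f;
  Tmu_assoc : forall W X Y Z (h : E (J Y) (Tobj Z)) (g : E (J X) (Tobj Y))
      (f : E (J W) (Tobj X)),
    assoc (ext Y Z h) (ext X Y g) (ext W X f)
        ∘ (Tmu h g ▷ ext W X f) ∘ Tmu (ext Y Z h · g) f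
      = (ext Y Z h ◁ Tmu g f) ∘ Tmu h (ext X Y g · f)
        ∘ fmap (ext W Z) (assoc (ext Y Z h) (ext X Y g) f)
        ∘ fmap (ext W Z) (Tmu h g ▷ f);
  Tmu_unit : forall X Y (f : E (J X) (Tobj Y)),
    (ext X Y f ◁ Ttheta X) ∘ Tmu f (Ti X) ∘ fmap (ext X Y) (Teta f)
      = bwd (runit (ext X Y f))
}.
Arguments ext {A E J} T {X Y} : rename.
Arguments Ti {A E J} T X : rename.
Arguments Tmu {A E J} T {X Y Z} g f : rename.
Arguments Teta {A E J} T {X Y} f : rename.
Arguments Ttheta {A E J} T X : rename.

Section PsAlg.

Context {A E : Bicategory} {J : Pseudofunctor A E} (T : RelPseudomonad J).

(* [aext a f], [ahat a g f] and [atilde a f] are [f^a], [\hat a_{g,f}] and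
   [\tilde a_f]. *)
Record PsAlgStr (K : E) := {
  aext : forall X, Functor (E (J X) K) (E (T X) K);
  ahat : forall X Y (g : E (J Y) K) (f : E (J X) (T Y)),
    aext X (aext Y g · f) ⟹ aext Y g · ext T f;
  atilde : forall X (f : E (J X) K), f ⟹ aext X f · Ti T X;
  ahat_iso : forall X Y (g : E (J Y) K) (f : E (J X) (T Y)),
    is_iso (ahat g f);
  atilde_iso : forall X (f : E (J X) K), is_iso (atilde f);
  ahat_nat_r : forall X Y (g : E (J Y) K) (f f' : E (J X) (T Y)) (α : f ⟹ f'),
    ahat g f' ∘ fmap (aext X) (aext Y g ◁ α)
      = (aext Y g ◁ fmap (ext T) α) ∘ ahat g f;
  ahat_nat_l : forall X Y (g g' : E (J Y) K) (f : E (J X) (T Y)) (β : g ⟹ g'),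
    ahat g' f ∘ fmap (aext X) (fmap (aext Y) β ▷ f)
      = (fmap (aext Y) β ▷ ext T f) ∘ ahat g f;
  atilde_nat : forall X (f f' : E (J X) K) (α : f ⟹ f'),
    atilde f' ∘ α = (fmap (aext X) α ▷ Ti T X) ∘ atilde f;
  ahat_assoc : forall X Y Z (h : E (J Z) K) (g : E (J Y) (T Z))
      (f : E (J X) (T Y)),
    assoc (aext Z h) (ext T g) (ext T f)
        ∘ (ahat h g ▷ ext T f) ∘ ahat (aext Z h · g) f
      = (aext Z h ◁ Tmu T g f) ∘ ahat h (ext T g · f)
        ∘ fmap (aext X) (assoc (aext Z h) (ext T g) f)
        ∘ fmap (aext X) (ahat h g ▷ f);
  ahat_unit : forall X (f : E (J X) K),
    (aext X f ◁ Ttheta T X) ∘ ahat f (Ti T X) ∘ fmap (aext X) (atilde f)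
      = bwd (runit (aext X f))
}.
#[global] Arguments aext {K} a {X} : rename.
#[global] Arguments ahat {K} a {X Y} g f : rename.
#[global] Arguments atilde {K} a {X} f : rename.

Record ColaxStr (K L : E) (a : PsAlgStr K) (b : PsAlgStr L) (h : E K L) := {
  bar : forall X (f : E (J X) K), h · aext a f ⟹ aext b (h · f);
  bar_nat : forall X (f f' : E (J X) K) (α : f ⟹ f'),
    bar f' ∘ (h ◁ fmap (aext a) α) = fmap (aext b) (h ◁ α) ∘ bar f;
  bar_hat : forall X Y (g : E (J Y) K) (f : E (J X) (T Y)),
    ahat b (h · g) f ∘ fmap (aext b) (bar g ▷ f)
        ∘ fmap (aext b) (bwd (assoc h (aext a g) f)) ∘ bar (aext a g · f)
      = (bar g ▷ ext T f) ∘ bwd (assoc h (aext a g) (ext T f))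
        ∘ (h ◁ ahat a g f);
  bar_tilde : forall X (f : E (J X) K),
    (bar f ▷ Ti T X) ∘ bwd (assoc h (aext a f) (Ti T X)) ∘ (h ◁ atilde a f)
      = atilde b (h · f)
}.
#[global] Arguments bar {K L a b h} s {X} f : rename.

(* A pseudomorphism is a colax morphism whose 2-cells are invertible; the
   2-cells [(hf)^b ⇒ hf^a] of the other convention are their inverses. *)
Definition IsPseudo (K L : E) (a : PsAlgStr K) (b : PsAlgStr L) (h : E K L)
    (s : ColaxStr a b h) : Prop :=
  forall X (f : E (J X) K), is_iso (bar s f).

Definition IsTransformation (K L : E) (a : PsAlgStr K) (b : PsAlgStr L)
    (h h' : E K L) (s : ColaxStr a b h) (s' : ColaxStr a b h')
    (α : h ⟹ h') : Prop :=
  forall X (f : E (J X) K),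
    fmap (aext b) (α ▷ f) ∘ bar s f = bar s' f ∘ (α ▷ aext a f).

End PsAlg.

Lemma post2 (C : Category) (w x y z : C) (b : y ⟹ z) (a : x ⟹ y) (q : x ⟹ z) :
  b ∘ a = q -> forall k : w ⟹ x, b ∘ (a ∘ k) = q ∘ k.
Proof. by move=> <- k; rewrite vcompA. Qed.

Lemma post3 (C : Category) (v w x y z : C) (c : y ⟹ z) (b : x ⟹ y) (a : w ⟹ x)
    (q : w ⟹ z) :
  c ∘ (b ∘ a) = q -> forall k : v ⟹ w, c ∘ (b ∘ (a ∘ k)) = q ∘ k.
Proof. by move=> <- k; rewrite !vcompA. Qed.

Lemma post4 (C : Category) (u v w x y z : C) (d : y ⟹ z) (c : x ⟹ y)
    (b : w ⟹ x) (a : v ⟹ w) (q : v ⟹ z) :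
  d ∘ (c ∘ (b ∘ a)) = q -> forall k : u ⟹ v, d ∘ (c ∘ (b ∘ (a ∘ k))) = q ∘ k.
Proof. by move=> <- k; rewrite !vcompA. Qed.

Lemma bwdKk (C : Category) (w x y : C) (i : Iso x y) (k : w ⟹ x) :
  bwd i ∘ (fwd i ∘ k) = k.
Proof. by rewrite vcompA bwdK vcomp_idl. Qed.

Lemma fwdKk (C : Category) (w x y : C) (i : Iso x y) (k : w ⟹ y) :
  fwd i ∘ (bwd i ∘ k) = k.
Proof. by rewrite vcompA fwdK vcomp_idl. Qed.

Lemma fwd_inj_l (C : Category) (w x y : C) (i : Iso x y) (p q : w ⟹ x) :
  fwd i ∘ p = fwd i ∘ q -> p = q.
Proof. by move=> H; rewrite -(bwdKk i p) H bwdKk. Qed.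

Lemma fwd_inj_r (C : Category) (x y z : C) (i : Iso x y) (p q : y ⟹ z) :
  p ∘ fwd i = q ∘ fwd i -> p = q.
Proof.
move=> H; rewrite -(vcomp_idr p) -(vcomp_idr q) -(fwdK i) !vcompA.
by rewrite H.
Qed.

Lemma square_inv (C : Category) (x y x' y' : C) (i : Iso x y) (i' : Iso x' y')
    (p : x ⟹ x') (q : y ⟹ y') :
  fwd i' ∘ p = q ∘ fwd i -> p ∘ bwd i = bwd i' ∘ q.
Proof.
move=> H; apply: (fwd_inj_l (i := i')); rewrite fwdKk vcompA H.
by rewrite -vcompA fwdK vcomp_idr.
Qed.

Lemma is_iso_id (C : Category) (x : C) : is_iso (idm x).
Proof. by exists (idm x); rewrite vcomp_idl. Qed.

Lemma is_iso_fwd (C : Category) (x y : C) (i : Iso x y) : is_iso (fwd i).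
Proof. by exists (bwd i); rewrite bwdK fwdK. Qed.

Lemma is_iso_bwd (C : Category) (x y : C) (i : Iso x y) : is_iso (bwd i).
Proof. by exists (fwd i); rewrite bwdK fwdK. Qed.

Lemma is_iso_comp (C : Category) (x y z : C) (g : y ⟹ z) (f : x ⟹ y) :
  is_iso g -> is_iso f -> is_iso (g ∘ f).
Proof.
move=> [g' [gK Kg]] [f' [fK Kf]]; exists (f' ∘ g'); rewrite -!vcompA.
by rewrite (post2 gK) vcomp_idl fK (post2 Kf) vcomp_idl Kg.
Qed.

Lemma is_iso_fmap (C D : Category) (F : Functor C D) (x y : C) (f : x ⟹ y) :
  is_iso f -> is_iso (fmap F f).
Proof.
by move=> [g [gf fg]]; exists (fmap F g); rewrite -!fmap_comp gf fg !fmap_id.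
Qed.

Lemma is_iso_lwhisker (E : Bicategory) (X Y Z : E) (h : E Y Z) (f g : E X Y)
    (α : f ⟹ g) : is_iso α -> is_iso (h ◁ α).
Proof.
move=> [β [βα αβ]]; exists (h ◁ β).
by rewrite -!lwhisker_comp βα αβ !lwhisker_id.
Qed.

Section BicategoryLemmas.

Variable E : Bicategory.

Lemma rwhisker_id1_inj (X Y : E) (f g : E X Y) (α β : f ⟹ g) :
  α ▷ id1 X = β ▷ id1 X -> α = β.
Proof.
by move=> H; apply: (fwd_inj_r (i := runit f)); rewrite -!runit_nat H.
Qed.

Lemma lwhisker_id1_inj (X Y : E) (f g : E X Y) (α β : f ⟹ g) :
  id1 Y ◁ α = id1 Y ◁ β -> α = β.
Proof.
by move=> H; apply: (fwd_inj_r (i := lunit f)); rewrite -!lunit_nat H.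
Qed.

Lemma lunit_comp (X Y Z : E) (g : E Y Z) (f : E X Y) :
  lunit (g · f) ∘ assoc (id1 Z) g f = lunit g ▷ f.
Proof.
apply: lwhisker_id1_inj; rewrite lwhisker_comp.
apply: (fwd_inj_r (i := assoc _ _ _)); rewrite -assoc_nat_m.
have R : is_iso (assoc (id1 Z) (id1 Z) g ▷ f).
  exists (bwd (assoc (id1 Z) (id1 Z) g) ▷ f).
  by rewrite -!rwhisker_comp bwdK fwdK !rwhisker_id.
case: R => k [_ kK].
rewrite -[LHS]vcomp_idr -[RHS]vcomp_idr -kK !vcompA; congr (_ ∘ k).
rewrite -!vcompA -rwhisker_comp triangle assoc_nat_l -triangle.
by have := pentagon (id1 Z) (id1 Z) g f; rewrite -!vcompA => ->.
Qed.

Lemma runit_comp (X Y Z : E) (g : E Y Z) (f : E X Y) :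
  (g ◁ runit f) ∘ assoc g f (id1 X) = runit (g · f).
Proof.
apply: rwhisker_id1_inj; rewrite rwhisker_comp.
apply: (fwd_inj_l (i := assoc _ _ _)); rewrite vcompA assoc_nat_m.
rewrite -triangle lwhisker_comp -(triangle (g · f) (id1 X)) !vcompA.
rewrite assoc_nat_r -!vcompA; congr (_ ∘ _).
by rewrite pentagon -!vcompA.
Qed.

Lemma assoc_inv_nat_r (W X Y Z : E) (h : E Y Z) (g : E X Y) (f f' : E W X)
    (α : f ⟹ f') :
  (h · g ◁ α) ∘ bwd (assoc h g f) = bwd (assoc h g f') ∘ (h ◁ (g ◁ α)).
Proof. exact/square_inv/assoc_nat_r. Qed.

Lemma assoc_inv_nat_m (W X Y Z : E) (h : E Y Z) (g g' : E X Y) (f : E W X)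
    (α : g ⟹ g') :
  ((h ◁ α) ▷ f) ∘ bwd (assoc h g f) = bwd (assoc h g' f) ∘ (h ◁ (α ▷ f)).
Proof. exact/square_inv/assoc_nat_m. Qed.

Lemma assoc_inv_nat_l (W X Y Z : E) (h h' : E Y Z) (g : E X Y) (f : E W X)
    (α : h ⟹ h') :
  ((α ▷ g) ▷ f) ∘ bwd (assoc h g f) = bwd (assoc h' g f) ∘ (α ▷ (g · f)).
Proof. exact/square_inv/assoc_nat_l. Qed.

Lemma lwhisker_fwdK (X Y Z : E) (h : E Y Z) (f g : E X Y) (i : Iso f g) :
  (h ◁ fwd i) ∘ (h ◁ bwd i) = idm _.
Proof. by rewrite -lwhisker_comp fwdK lwhisker_id. Qed.

Lemma lwhisker_bwdK (X Y Z : E) (h : E Y Z) (f g : E X Y) (i : Iso f g) :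
  (h ◁ bwd i) ∘ (h ◁ fwd i) = idm _.
Proof. by rewrite -lwhisker_comp bwdK lwhisker_id. Qed.

Lemma rwhisker_fwdK (X Y Z : E) (f g : E Y Z) (i : Iso f g) (e : E X Y) :
  (fwd i ▷ e) ∘ (bwd i ▷ e) = idm _.
Proof. by rewrite -rwhisker_comp fwdK rwhisker_id. Qed.

Lemma rwhisker_bwdK (X Y Z : E) (f g : E Y Z) (i : Iso f g) (e : E X Y) :
  (bwd i ▷ e) ∘ (fwd i ▷ e) = idm _.
Proof. by rewrite -rwhisker_comp bwdK rwhisker_id. Qed.

Lemma lunit_comp_inv (X Y Z : E) (g : E Y Z) (f : E X Y) :
  (lunit g ▷ f) ∘ bwd (assoc (id1 Z) g f) = lunit (g · f).
Proof. by rewrite -lunit_comp -vcompA fwdK vcomp_idr. Qed.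

Lemma pentagon_inv (V W X Y Z : E) (k : E Y Z) (h : E X Y) (g : E W X)
    (f : E V W) :
  (assoc k h g ▷ f) ∘ (bwd (assoc (k · h) g f) ∘ bwd (assoc k h (g · f)))
    = bwd (assoc k (h · g) f) ∘ (k ◁ bwd (assoc h g f)).
Proof.
apply: (fwd_inj_l (i := assoc k (h · g) f)); rewrite fwdKk.
rewrite -[LHS]vcomp_idl -(lwhisker_bwdK k (assoc h g f)) -!vcompA.
have := pentagon k h g f; rewrite -!vcompA => P.
rewrite (post3 (eq_sym P)) -!vcompA.
by rewrite fwdKk fwdK vcomp_idr.
Qed.

End BicategoryLemmas.

Section PsAlgBicategory.

Context {A E : Bicategory} {J : Pseudofunctor A E} (T : RelPseudomonad J).

Definition colax_id_bar (K : E) (a : PsAlgStr T K) X (f : E (J X) K) :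
    id1 K · aext a f ⟹ aext a (id1 K · f) :=
  fmap (aext a) (bwd (lunit f)) ∘ lunit (aext a f).

Definition colax_comp_bar (K L M : E) (a : PsAlgStr T K) (b : PsAlgStr T L)
    (c : PsAlgStr T M) (h' : E L M) (h : E K L)
    (s' : ColaxStr b c h') (s : ColaxStr a b h) X (f : E (J X) K) :
    (h' · h) · aext a f ⟹ aext c ((h' · h) · f) :=
  fmap (aext c) (bwd (assoc h' h f)) ∘ bar s' (h · f) ∘ (h' ◁ bar s f)
    ∘ assoc h' h (aext a f).

Lemma colax_id_nat (K : E) (a : PsAlgStr T K) X (f f' : E (J X) K)
    (α : f ⟹ f') :
  colax_id_bar a f' ∘ (id1 K ◁ fmap (aext a) α)
    = fmap (aext a) (id1 K ◁ α) ∘ colax_id_bar a f.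
Proof.
rewrite /colax_id_bar -!vcompA lunit_nat !vcompA -!fmap_comp; congr (fmap _ _ ∘ _).
by apply: eq_sym; apply: square_inv; apply: lunit_nat.
Qed.

Lemma colax_id_hat (K : E) (a : PsAlgStr T K) X Y (g : E (J Y) K)
    (f : E (J X) (T Y)) :
  ahat a (id1 K · g) f ∘ fmap (aext a) (colax_id_bar a g ▷ f)
      ∘ fmap (aext a) (bwd (assoc (id1 K) (aext a g) f))
      ∘ colax_id_bar a (aext a g · f)
    = (colax_id_bar a g ▷ ext T f)
      ∘ bwd (assoc (id1 K) (aext a g) (ext T f)) ∘ (id1 K ◁ ahat a g f).
Proof.
rewrite /colax_id_bar !rwhisker_comp !fmap_comp -!vcompA.
rewrite (post2 (ahat_nat_l _ _ _)) (post2 (lunit_comp_inv _ _)) lunit_nat.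
rewrite -!vcompA; congr (_ ∘ (_ ∘ _)).
rewrite !vcompA -!fmap_comp lunit_comp_inv fwdK fmap_id.
by rewrite vcomp_idl.
Qed.

Lemma colax_id_tilde (K : E) (a : PsAlgStr T K) X (f : E (J X) K) :
  (colax_id_bar a f ▷ Ti T X) ∘ bwd (assoc (id1 K) (aext a f) (Ti T X))
      ∘ (id1 K ◁ atilde a f)
    = atilde a (id1 K · f).
Proof.
rewrite /colax_id_bar rwhisker_comp -!vcompA (post2 (lunit_comp_inv _ _)).
rewrite lunit_nat (post2 (eq_sym (atilde_nat _ _))) -vcompA bwdK.
by rewrite vcomp_idr.
Qed.

Definition colax_id (K : E) (a : PsAlgStr T K) : ColaxStr a a (id1 K) :=
  Build_ColaxStr (@colax_id_nat K a) (@colax_id_hat K a) (@colax_id_tilde K a).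

Section ColaxComp.

Variables (K L M : E) (a : PsAlgStr T K) (b : PsAlgStr T L) (c : PsAlgStr T M).
Variables (h' : E L M) (h : E K L) (s' : ColaxStr b c h') (s : ColaxStr a b h).

Lemma colax_comp_nat X (f f' : E (J X) K) (α : f ⟹ f') :
  colax_comp_bar s' s f' ∘ (h' · h ◁ fmap (aext a) α)
    = fmap (aext c) (h' · h ◁ α) ∘ colax_comp_bar s' s f.
Proof.
rewrite /colax_comp_bar -!vcompA assoc_nat_r.
rewrite (post2 (eq_sym (lwhisker_comp _ _ _))) bar_nat lwhisker_comp -!vcompA.
rewrite (post2 (bar_nat _ _)) -!vcompA !(post2 (eq_sym (fmap_comp _ _ _))).
by rewrite assoc_inv_nat_r.
Qed.

Lemma colax_comp_hat X Y (g : E (J Y) K) (f : E (J X) (T Y)) :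
  ahat c ((h' · h) · g) f ∘ fmap (aext c) (colax_comp_bar s' s g ▷ f)
      ∘ fmap (aext c) (bwd (assoc (h' · h) (aext a g) f))
      ∘ colax_comp_bar s' s (aext a g · f)
    = (colax_comp_bar s' s g ▷ ext T f)
      ∘ bwd (assoc (h' · h) (aext a g) (ext T f)) ∘ (h' · h ◁ ahat a g f).
Proof.
rewrite /colax_comp_bar !rwhisker_comp !fmap_comp -!vcompA.
rewrite (post2 (ahat_nat_l _ _ _)) -!vcompA; congr (_ ∘ _).
have P : fmap (aext c) (assoc h' h (aext a g) ▷ f)
    ∘ (fmap (aext c) (bwd (assoc (h' · h) (aext a g) f))
       ∘ fmap (aext c) (bwd (assoc h' h (aext a g · f))))
  = fmap (aext c) (bwd (assoc h' (h · aext a g) f))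
    ∘ fmap (aext c) (h' ◁ bwd (assoc h (aext a g) f)).
  by rewrite -!fmap_comp pentagon_inv.
rewrite (post3 P) -!vcompA (post2 (eq_sym (bar_nat s' _))) -!vcompA.
have Q : fmap (aext c) ((h' ◁ bar s g) ▷ f)
    ∘ fmap (aext c) (bwd (assoc h' (h · aext a g) f))
  = fmap (aext c) (bwd (assoc h' (aext b (h · g)) f))
    ∘ fmap (aext c) (h' ◁ (bar s g ▷ f)).
  by rewrite -!fmap_comp assoc_inv_nat_m.
rewrite (post2 Q) -!vcompA (post2 (eq_sym (bar_nat s' _))) -!vcompA.
have := bar_hat s' (h · g) f; rewrite -!vcompA => H'.
rewrite (post4 H') -!vcompA; congr (_ ∘ _).
have := f_equal (fun z => h' ◁ z) (bar_hat s g f).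
rewrite /= !lwhisker_comp -!vcompA => H.
rewrite (post4 H) -!vcompA -assoc_nat_r.
rewrite (post2 (eq_sym (assoc_inv_nat_m _ _ _))) -!vcompA; congr (_ ∘ _).
rewrite !vcompA; congr (_ ∘ _); rewrite -pentagon_inv -!vcompA bwdK.
by rewrite vcomp_idr.
Qed.

Lemma colax_comp_tilde X (f : E (J X) K) :
  (colax_comp_bar s' s f ▷ Ti T X)
      ∘ bwd (assoc (h' · h) (aext a f) (Ti T X)) ∘ (h' · h ◁ atilde a f)
    = atilde c ((h' · h) · f).
Proof.
rewrite /colax_comp_bar !rwhisker_comp -!vcompA.
have -> : (h' · h ◁ atilde a f)
  = bwd (assoc h' h (aext a f · Ti T X))
    ∘ ((h' ◁ (h ◁ atilde a f)) ∘ assoc h' h f).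
  by rewrite -assoc_nat_r bwdKk.
rewrite (post3 (pentagon_inv _ _ _ _)) -!vcompA.
rewrite (post2 (assoc_inv_nat_m _ _ _)) -!vcompA.
have := f_equal (fun z => h' ◁ z) (bar_tilde s f).
rewrite /= !lwhisker_comp -!vcompA => H; rewrite (post3 H).
have := bar_tilde s' (h · f); rewrite -!vcompA => H'; rewrite (post3 H').
rewrite (post2 (eq_sym (atilde_nat _ _))) -vcompA bwdK.
by rewrite vcomp_idr.
Qed.

Definition colax_comp : ColaxStr a c (h' · h) :=
  Build_ColaxStr colax_comp_nat colax_comp_hat colax_comp_tilde.

End ColaxComp.

Lemma pseudo_id (K : E) (a : PsAlgStr T K) : IsPseudo (colax_id a).
Proof.
move=> X f; apply: is_iso_comp; last exact: is_iso_fwd.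
exact/is_iso_fmap/is_iso_bwd.
Qed.

Lemma pseudo_comp (K L M : E) (a : PsAlgStr T K) (b : PsAlgStr T L)
    (c : PsAlgStr T M) (h' : E L M) (h : E K L)
    (s' : ColaxStr b c h') (s : ColaxStr a b h) :
  IsPseudo s' -> IsPseudo s -> IsPseudo (colax_comp s' s).
Proof.
move=> i' i X f; apply: is_iso_comp; last exact: is_iso_fwd.
apply: is_iso_comp; last exact/is_iso_lwhisker/i.
by apply: is_iso_comp (i' _ _); exact/is_iso_fmap/is_iso_bwd.
Qed.

Section Transformations.

Variables (K L : E) (a : PsAlgStr T K) (b : PsAlgStr T L).

Lemma transf_id (h : E K L) (s : ColaxStr a b h) :
  IsTransformation s s (idm h).
Proof. by move=> X f; rewrite !rwhisker_id fmap_id vcomp_idl vcomp_idr. Qed.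

Lemma transf_vcomp (h h' h'' : E K L) (s : ColaxStr a b h)
    (s' : ColaxStr a b h') (s'' : ColaxStr a b h'') (β : h' ⟹ h'')
    (α : h ⟹ h') :
  IsTransformation s' s'' β -> IsTransformation s s' α ->
  IsTransformation s s'' (β ∘ α).
Proof.
move=> Hβ Hα X f; rewrite !rwhisker_comp fmap_comp -vcompA Hα vcompA Hβ.
by rewrite vcompA.
Qed.

Lemma transf_bwd (h h' : E K L) (s : ColaxStr a b h) (s' : ColaxStr a b h')
    (i : Iso h h') :
  IsTransformation s s' i -> IsTransformation s' s (bwd i).
Proof.
move=> H X f; rewrite -[LHS]vcomp_idr -(rwhisker_fwdK i) -[LHS]vcompA.
rewrite [bar s' f ∘ _]vcompA -H !vcompA -fmap_comp rwhisker_bwdK.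
by rewrite fmap_id vcomp_idl.
Qed.

End Transformations.

Lemma transf_lwhisker (K L M : E) (a : PsAlgStr T K) (b : PsAlgStr T L)
    (c : PsAlgStr T M) (k : E L M) (h h' : E K L) (t : ColaxStr b c k)
    (s : ColaxStr a b h) (s' : ColaxStr a b h') (α : h ⟹ h') :
  IsTransformation s s' α ->
  IsTransformation (colax_comp t s) (colax_comp t s') (k ◁ α).
Proof.
move=> H X f; rewrite /= /colax_comp_bar -!vcompA assoc_nat_m.
rewrite (post2 (eq_sym (lwhisker_comp _ _ _))) -H lwhisker_comp -!vcompA.
rewrite (post2 (bar_nat _ _)) -!vcompA !(post2 (eq_sym (fmap_comp _ _ _))).
by rewrite assoc_inv_nat_m.
Qed.

Lemma transf_rwhisker (K L M : E) (a : PsAlgStr T K) (b : PsAlgStr T L)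
    (c : PsAlgStr T M) (k k' : E L M) (h : E K L) (t : ColaxStr b c k)
    (t' : ColaxStr b c k') (s : ColaxStr a b h) (α : k ⟹ k') :
  IsTransformation t t' α ->
  IsTransformation (colax_comp t s) (colax_comp t' s) (α ▷ h).
Proof.
move=> H X f; rewrite /= /colax_comp_bar -!vcompA assoc_nat_l.
rewrite (post2 (eq_sym (interchange _ _))) -!vcompA (post2 (eq_sym (H _ _))) -!vcompA.
by rewrite !(post2 (eq_sym (fmap_comp _ _ _))) assoc_inv_nat_l.
Qed.

Lemma transf_assoc (K L M N : E) (a : PsAlgStr T K) (b : PsAlgStr T L)
    (c : PsAlgStr T M) (d : PsAlgStr T N) (k : E M N) (h : E L M) (g : E K L)
    (u : ColaxStr c d k) (t : ColaxStr b c h) (s : ColaxStr a b g) :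
  IsTransformation (colax_comp (colax_comp u t) s)
    (colax_comp u (colax_comp t s)) (assoc k h g).
Proof.
move=> X f; rewrite /= /colax_comp_bar /= /colax_comp_bar.
rewrite !lwhisker_comp -!vcompA.
have := pentagon k h g (aext a f); rewrite -!vcompA => <-.
rewrite (post2 (bar_nat u _)) -!vcompA.
have P : fmap (aext d) (assoc k h g ▷ f)
    ∘ (fmap (aext d) (bwd (assoc (k · h) g f))
       ∘ fmap (aext d) (bwd (assoc k h (g · f))))
  = fmap (aext d) (bwd (assoc k (h · g) f))
    ∘ fmap (aext d) (k ◁ bwd (assoc h g f)).
  by rewrite -!fmap_comp pentagon_inv.
by rewrite (post3 P) -!vcompA (post2 (assoc_nat_r _ _ _)) -!vcompA.
Qed.

Lemma transf_lunit (K L : E) (a : PsAlgStr T K) (b : PsAlgStr T L) (h : E K L)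
    (s : ColaxStr a b h) :
  IsTransformation (colax_comp (colax_id b) s) s (lunit h).
Proof.
move=> X f; rewrite /= /colax_comp_bar /= /colax_id_bar -!vcompA.
rewrite (post2 (lunit_nat _)) -!vcompA lunit_comp.
rewrite !(post2 (eq_sym (fmap_comp _ _ _))) lunit_comp_inv fwdK fmap_id.
by rewrite vcomp_idl.
Qed.

Lemma transf_runit (K L : E) (a : PsAlgStr T K) (b : PsAlgStr T L) (h : E K L)
    (s : ColaxStr a b h) :
  IsTransformation (colax_comp s (colax_id a)) s (runit h).
Proof.
move=> X f; rewrite /= /colax_comp_bar /= /colax_id_bar lwhisker_comp -!vcompA.
rewrite (post2 (bar_nat _ _)) -!vcompA triangle.
rewrite !(post2 (eq_sym (fmap_comp _ _ _))) -triangle -!vcompA fwdKk.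
by rewrite lwhisker_fwdK fmap_id vcomp_idl.
Qed.

Record Pseudoalgebra := {
  carrier :> E;
  structure :> PsAlgStr T carrier
}.

Record ColaxMorphism (a b : Pseudoalgebra) := {
  cell :> E a b;
  colax :> ColaxStr a b cell
}.

Definition Transformation (a b : Pseudoalgebra) (h h' : ColaxMorphism a b) : Type :=
  {α : cell h ⟹ cell h' | IsTransformation h h' α}.

Lemma transf_eq (a b : Pseudoalgebra) (h h' : ColaxMorphism a b)
    (α β : Transformation h h') : proj1_sig α = proj1_sig β -> α = β.
Proof. by apply: eq_sig_hprop => x; apply: proof_irrelevance. Qed.

Definition PsAlg_homcat (a b : Pseudoalgebra) : Category.
Proof.
refine {| obj := ColaxMorphism a b; Hom := @Transformation a b;
  idm h := exist _ (idm (cell h)) (transf_id h);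
  vcomp h h' h'' β α :=
    exist _ (proj1_sig β ∘ proj1_sig α)
      (transf_vcomp (proj2_sig β) (proj2_sig α)) |}.
- by move=> x y f; apply: transf_eq; apply: vcomp_idl.
- by move=> x y f; apply: transf_eq; apply: vcomp_idr.
- by move=> w x y z h g f; apply: transf_eq; apply: vcompA.
Defined.

Definition PsAlg_iso (a b : Pseudoalgebra) (h h' : PsAlg_homcat a b)
    (i : Iso (cell h) (cell h')) (p : IsTransformation h h' i) : Iso h h'.
Proof.
refine {| fwd := exist _ (fwd i) p : Hom (c := PsAlg_homcat a b) h h';
  bwd := exist _ (bwd i) (transf_bwd p) |}.
- by apply: transf_eq; apply: bwdK.
- by apply: transf_eq; apply: fwdK.
Defined.

Definition PsAlg_id1 (a : Pseudoalgebra) : PsAlg_homcat a a :=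
  Build_ColaxMorphism (colax_id a).

Definition PsAlg_comp1 (a b c : Pseudoalgebra) (h' : PsAlg_homcat b c)
    (h : PsAlg_homcat a b) : PsAlg_homcat a c :=
  Build_ColaxMorphism (colax_comp h' h).

Definition PsAlgc : Bicategory.
Proof.
refine {| cell0 := Pseudoalgebra; homcat := PsAlg_homcat;
  id1 := PsAlg_id1; comp1 := PsAlg_comp1;
  lwhisker a b c k h h' α :=
    exist _ (cell k ◁ proj1_sig α) (transf_lwhisker k (proj2_sig α));
  rwhisker a b c k k' α h :=
    exist _ (proj1_sig α ▷ cell h) (transf_rwhisker h (proj2_sig α));
  assoc a b c d k h g := @PsAlg_iso a d (PsAlg_comp1 (PsAlg_comp1 k h) g)
    (PsAlg_comp1 k (PsAlg_comp1 h g)) _ (transf_assoc k h g);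
  lunit a b h := @PsAlg_iso a b (PsAlg_comp1 (PsAlg_id1 b) h) h _ (transf_lunit h);
  runit a b h := @PsAlg_iso a b (PsAlg_comp1 h (PsAlg_id1 a)) h _ (transf_runit h) |}; intros; apply: transf_eq.
- exact: lwhisker_id.
- exact: lwhisker_comp.
- exact: rwhisker_id.
- exact: rwhisker_comp.
- exact: interchange.
- exact: lunit_nat.
- exact: runit_nat.
- exact: assoc_nat_r.
- exact: assoc_nat_m.
- exact: assoc_nat_l.
- exact: pentagon.
- exact: triangle.
Defined.

End PsAlgBicategory.

(* The locally full sub-bicategory on the 1-cells satisfying P. *)
Section LocallyFull.

Context {B : Bicategory} {P : forall X Y : B, B X Y -> Prop}.
Context (P_id1 : forall X : B, P (id1 X)).
Context (P_comp1 : forall (X Y Z : B) (g : B Y Z) (f : B X Y),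
  P g -> P f -> P (g · f)).

Definition locally_full_homcat (X Y : B) : Category := {|
  obj := {f : B X Y | P f};
  Hom f g := proj1_sig f ⟹ proj1_sig g;
  idm f := idm (proj1_sig f);
  vcomp f g h β α := β ∘ α;
  vcomp_idl f g α := vcomp_idl α;
  vcomp_idr f g α := vcomp_idr α;
  vcompA e f g h γ β α := vcompA γ β α
|}.

Definition locally_full_iso (X Y : B) (f g : locally_full_homcat X Y)
    (i : Iso (proj1_sig f) (proj1_sig g)) : Iso f g :=
  Build_Iso (C := locally_full_homcat X Y) (x := f) (y := g)
    (bwdK i) (fwdK i).

Definition locally_full_id1 (X : B) : locally_full_homcat X X :=
  exist _ (id1 X) (P_id1 X).

Definition locally_full_comp1 (X Y Z : B) (g : locally_full_homcat Y Z)
    (f : locally_full_homcat X Y) : locally_full_homcat X Z :=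
  exist _ (proj1_sig g · proj1_sig f) (P_comp1 (proj2_sig g) (proj2_sig f)).

Definition locally_full : Bicategory.
Proof.
refine {| cell0 := B; homcat := locally_full_homcat;
  id1 := locally_full_id1; comp1 := locally_full_comp1;
  lwhisker X Y Z h f g α := proj1_sig h ◁ α;
  rwhisker X Y Z g h α f := α ▷ proj1_sig f;
  assoc W X Y Z h g f := @locally_full_iso W Z
    (locally_full_comp1 (locally_full_comp1 h g) f)
    (locally_full_comp1 h (locally_full_comp1 g f))
    (assoc (proj1_sig h) (proj1_sig g) (proj1_sig f));
  lunit X Y f := @locally_full_iso X Y
    (locally_full_comp1 (locally_full_id1 Y) f) f (lunit (proj1_sig f));
  runit X Y f := @locally_full_iso X Y
    (locally_full_comp1 f (locally_full_id1 X)) f (runit (proj1_sig f)) |};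
  intros.
- exact: lwhisker_id.
- exact: lwhisker_comp.
- exact: rwhisker_id.
- exact: rwhisker_comp.
- exact: interchange.
- exact: lunit_nat.
- exact: runit_nat.
- exact: assoc_nat_r.
- exact: assoc_nat_m.
- exact: assoc_nat_l.
- exact: pentagon.
- exact: triangle.
Defined.

End LocallyFull.

Section Lifting.

Context {A E : Bicategory} {J : Pseudofunctor A E} (T : RelPseudomonad J).

Definition PsAlg : Bicategory :=
  locally_full (B := PsAlgc T) (P := fun a b h => IsPseudo (colax h))
    (fun a => pseudo_id a) (fun a b c h' h p' p => pseudo_comp p' p).

Definition psalg (K : E) (a : PsAlgStr T K) : PsAlgc T :=
  Build_Pseudoalgebra a.

Definition colax_cell (K L : E) (a : PsAlgStr T K) (b : PsAlgStr T L)
    (h : E K L) (s : ColaxStr a b h) : PsAlgc T (psalg a) (psalg b) :=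
  Build_ColaxMorphism (a := psalg a) (b := psalg b) s.

Definition pseudo_cell (K L : E) (a : PsAlgStr T K) (b : PsAlgStr T L)
    (h : E K L) (s : ColaxStr a b h) (p : IsPseudo s) :
    PsAlg (psalg a) (psalg b) :=
  exist (fun t : ColaxMorphism _ _ => IsPseudo (colax t)) (colax_cell s) p.

Context {K L : E} {l : E K L} {r : E L K} (ν : id1 K ⟹ r · l)
  (ε : l · r ⟹ id1 L) {a : PsAlgStr T K} {b : PsAlgStr T L}
  (sl : ColaxStr a b l) (sr : ColaxStr b a r).

Definition LiftsToPsAlgc : Prop :=
  exists (tν : IsTransformation (colax_id a) (colax_comp sr sl) ν)
         (tε : IsTransformation (colax_comp sl sr) (colax_id b) ε),
    IsAdjunction (l := colax_cell sl) (r := colax_cell sr)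
      (exist _ ν tν) (exist _ ε tε).

Definition LiftsToPsAlg : Prop :=
  exists (pl : IsPseudo sl) (pr : IsPseudo sr)
         (tν : IsTransformation (colax_id a) (colax_comp sr sl) ν)
         (tε : IsTransformation (colax_comp sl sr) (colax_id b) ε),
    IsAdjunction (l := pseudo_cell pl) (r := pseudo_cell pr)
      (exist _ ν tν) (exist _ ε tε).

End Lifting.

(* The 2-cell [l(rf) ≅ (lr)f ⇒ 1f ≅ f] that the mathematics writes [εf]. *)
Definition counit_at (E : Bicategory) (K L : E) (l : E K L) (r : E L K)
    (ε : l · r ⟹ id1 L) (X : E) (f : E X L) : l · (r · f) ⟹ f :=
  lunit f ∘ (ε ▷ f) ∘ bwd (assoc l r f).

Definition comparison (A E : Bicategory) (J : Pseudofunctor A E)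
    (T : RelPseudomonad J) (K L : E) (b : PsAlgStr T L) (l : E K L)
    (r : E L K) (ε : l · r ⟹ id1 L) (X : A) (f : E (J X) L) :
    r · aext b (l · (r · f)) ⟹ r · aext b f :=
  r ◁ fmap (aext b) (counit_at ε f).

(* Main.v *)
From Stdlib Require Import ssreflect ClassicalEpsilon.
Require Import Defs.
Local Open Scope bicat_scope.
Set Implicit Arguments.
Unset Strict Implicit.
Unset Printing Implicit Defensive.

(** The adjunction [l ⊣ r] induces, for every [X], an adjunction between the
    hom-categories [E X K] and [E X L], with unit [unit_at ν] and counit
    [counit_at ε].  Extending along [l] and coming back along [r] turns the
    extension operator of [b] into one on [K], namely [f ↦ r · (l·f)^b].
    Its unit constraint is that of [b] preceded by the unit of the adjunction,
    hence invertible because the adjunction is coreflective.  Its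
    multiplication constraint has to remove the composite [l · r] standing
    between the two extensions; it does so with the counit, applied inside
    [r · (-)^b], and up to associators this is an instance of the comparison.
    Invertibility of the comparison is therefore what makes [K] a
    pseudoalgebra ([transfer]).

    The structure of [l] is then the counit at [(l·f)^b], and that of [r] is
    the inverse of the comparison.  Every axiom of [K], of [l] and of [r]
    becomes the corresponding axiom of [b] once the counit is moved past
    everything by naturality, and the unit and counit are transformations by
    the two triangle identities ([unit_transf], [counit_transf]).  An
    equivalence has an invertible counit, so both the comparison and the
    structure of [l] are invertible in that case.

    The converse is a doctrinal adjunction argument.  For any lift, the mate of
    the structure of [l] is a 2-cell [mate g] from [g^a] to [r · (l·g)^b], and
    the comparison at [f] after [mate (r·f)] is a two-sided inverse of the
    structure of [r] at [f] ([right_bar_mate], [mate_right_bar]).  Since the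
    unit is an invertible transformation, the structure of [r] at [l·g] after
    [mate g] is invertible too, so every mate is invertible and hence so is the
    comparison. *)

(** * Invertible 2-cells *)

Lemma is_iso_rwhisker (E : Bicategory) (X Y Z : E) (g h : E Y Z) (α : g ⟹ h)
    (f : E X Y) : is_iso α -> is_iso (α ▷ f).
Proof.
move=> [β [βα αβ]]; exists (β ▷ f).
by rewrite -!rwhisker_comp βα αβ !rwhisker_id.
Qed.

Lemma is_iso_cancel_l (C : Category) (x y z : C) (g : y ⟹ z) (f : x ⟹ y) :
  is_iso g -> is_iso (g ∘ f) -> is_iso f.
Proof.
move=> [g' [g'g gg']] gf; rewrite -(vcomp_idl f) -g'g -vcompA.
by apply: is_iso_comp => //; exists g.
Qed.

Lemma is_iso_cancel_r (C : Category) (x y z : C) (g : y ⟹ z) (f : x ⟹ y) :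
  is_iso f -> is_iso (g ∘ f) -> is_iso g.
Proof.
move=> [f' [f'f ff']] gf; rewrite -(vcomp_idr g) -ff' vcompA.
by apply: is_iso_comp => //; exists f.
Qed.

(** Invertibility is a mere existence statement, while the 2-cells of a
    morphism structure are data; choosing an inverse bridges the two. *)
Definition iso_of (C : Category) (x y : C) (f : x ⟹ y) (i : is_iso f) :
    Iso x y :=
  let (g, gK) := constructive_indefinite_description _ i in
  {| fwd := f; bwd := g; bwdK := proj1 gK; fwdK := proj2 gK |}.

Lemma fwd_iso_of (C : Category) (x y : C) (f : x ⟹ y) (i : is_iso f) :
  fwd (iso_of i) = f.
Proof. by rewrite /iso_of; case: constructive_indefinite_description. Qed.

(** Re-association that keeps defined composites such as [counit_at] and
    [unit_at] folded: [rewrite <-] matches syntactically, whereas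
    [rewrite -!vcompA] unfolds them to re-associate inside. *)
Ltac rassoc := repeat rewrite <- vcompA.
Ltac lassoc := repeat rewrite -> vcompA.

(** * Two forms of the pentagon *)

Section Coherence.

Context {E : Bicategory}.

Lemma pentagon_bwd (V W X Y Z : E) (k : E Y Z) (h : E X Y) (g : E W X)
    (f : E V W) :
  bwd (assoc k h (g · f)) ∘ ((k ◁ assoc h g f) ∘ assoc k (h · g) f)
    = assoc (k · h) g f ∘ (bwd (assoc k h g) ▷ f).
Proof.
apply: (fwd_inj_l (i := assoc k h (g · f))).
by rewrite fwdKk vcompA pentagon -!vcompA rwhisker_fwdK vcomp_idr.
Qed.

Lemma pentagon_lwhisker_bwd (V W X Y Z : E) (k : E Y Z) (h : E X Y) (g : E W X)
    (f : E V W) :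
  (k ◁ bwd (assoc h g f)) ∘ (assoc k h (g · f) ∘ assoc (k · h) g f)
    = assoc k (h · g) f ∘ (assoc k h g ▷ f).
Proof.
rewrite pentagon -!vcompA (post2 (lwhisker_bwdK _ _)).
by rewrite vcomp_idl.
Qed.

End Coherence.

(** * The adjunction on hom-categories *)

Section Adjunction.

Context {E : Bicategory} {K L : E} {l : E K L} {r : E L K}
  (ν : id1 K ⟹ r · l) (ε : l · r ⟹ id1 L).

Definition unit_at (X : E) (f : E X K) : f ⟹ r · (l · f) :=
  assoc r l f ∘ (ν ▷ f) ∘ bwd (lunit f).

Lemma counit_at_nat (X : E) (f f' : E X L) (α : f ⟹ f') :
  counit_at ε f' ∘ (l ◁ (r ◁ α)) = α ∘ counit_at ε f.
Proof.
rewrite /counit_at -!vcompA -assoc_inv_nat_r (post2 (interchange _ _)).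
by rewrite -vcompA (post2 (lunit_nat _)) -!vcompA.
Qed.

Lemma unit_at_nat (X : E) (f f' : E X K) (α : f ⟹ f') :
  unit_at f' ∘ α = (r ◁ (l ◁ α)) ∘ unit_at f.
Proof.
rewrite /unit_at -!vcompA -(square_inv (lunit_nat α)).
rewrite (post2 (interchange _ _)) -!vcompA.
by rewrite (post2 (assoc_nat_r _ _ _)) -!vcompA.
Qed.

(** The hom-adjunctions are compatible with precomposition, up to the
    associators moving [h] past [l] and [r]. *)
Lemma counit_at_rwhisker (X Y : E) (f : E Y L) (h : E X Y) :
  counit_at ε f ▷ h
    = counit_at ε (f · h) ∘ ((l ◁ assoc r f h) ∘ assoc l (r · f) h).
Proof.
rewrite /counit_at !rwhisker_comp -!vcompA pentagon_bwd -lunit_comp -!vcompA.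
by rewrite (post2 (assoc_nat_l _ _ _)) -!vcompA.
Qed.

Lemma is_iso_counit_at (X : E) (f : E X L) :
  is_iso ε -> is_iso (counit_at ε f).
Proof.
move=> i; apply: is_iso_comp (is_iso_bwd _).
by apply: is_iso_comp; [exact: is_iso_fwd | exact: is_iso_rwhisker].
Qed.

Lemma is_iso_unit_at (X : E) (f : E X K) : is_iso ν -> is_iso (unit_at f).
Proof.
move=> i; apply: is_iso_comp (is_iso_bwd _).
by apply: is_iso_comp; [exact: is_iso_fwd | exact: is_iso_rwhisker].
Qed.

Hypothesis adj : IsAdjunction ν ε.

(** The first triangle identity whiskered with [f]; the associators and unitors
    cancel by the pentagon and the triangle axiom. *)
Lemma counit_unit_at (X : E) (f : E X K) :
  counit_at ε (l · f) ∘ (l ◁ unit_at f) = idm (l · f).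
Proof.
rewrite -rwhisker_id -(adj_triangle_l adj) /counit_at /unit_at.
rewrite !rwhisker_comp !lwhisker_comp -!vcompA -lunit_comp -!vcompA.
rewrite (post2 (assoc_nat_l _ _ _)) -!vcompA.
rewrite (post2 (eq_sym (pentagon_bwd _ _ _ _))) -!vcompA.
rewrite (post2 (assoc_nat_m _ _ _)) -!vcompA.
have -> : l ◁ bwd (lunit f) = assoc l (id1 K) f ∘ (bwd (runit l) ▷ f).
  rewrite -[RHS]vcomp_idl -(lwhisker_bwdK l (lunit f)) -!vcompA.
  by rewrite (post2 (triangle _ _)) rwhisker_fwdK vcomp_idr.
by [].
Qed.

Lemma unit_counit_at (X : E) (f : E X L) :
  (r ◁ counit_at ε f) ∘ unit_at (r · f) = idm (r · f).
Proof.
rewrite -rwhisker_id -(adj_triangle_r adj) /counit_at /unit_at.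
rewrite !rwhisker_comp !lwhisker_comp -!vcompA -triangle -!vcompA.
rewrite (post2 (assoc_nat_m _ _ _)) -!vcompA.
rewrite (post2 (eq_sym (pentagon_lwhisker_bwd _ _ _ _))) -!vcompA.
rewrite (post2 (assoc_nat_l _ _ _)) -!vcompA.
have -> // : bwd (lunit (r · f)) = assoc (id1 K) r f ∘ (bwd (lunit r) ▷ f).
apply: (fwd_inj_l (i := lunit (r · f))).
by rewrite fwdK vcompA lunit_comp rwhisker_fwdK.
Qed.

(** Transposing along the hom-adjunction and back. *)
Lemma counit_at_transpose (X : E) (f : E X K) (g : E X L) (β : l · f ⟹ g) :
  counit_at ε g ∘ (l ◁ ((r ◁ β) ∘ unit_at f)) = β.
Proof.
rewrite lwhisker_comp vcompA counit_at_nat; rassoc.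
by rewrite counit_unit_at vcomp_idr.
Qed.

(** The counit in the position where the multiplication constraint needs it:
    [r · g] is an inner extension on [K], and [l] comes from the outer one. *)
Definition absorb (X Y : E) (g : E Y L) (f : E X Y) :
    l · ((r · g) · f) ⟹ g · f :=
  counit_at ε (g · f) ∘ (l ◁ assoc r g f).

Lemma absorb_nat_l (X Y : E) (g g' : E Y L) (f : E X Y) (β : g ⟹ g') :
  absorb g' f ∘ (l ◁ ((r ◁ β) ▷ f)) = (β ▷ f) ∘ absorb g f.
Proof.
rewrite /absorb; rassoc; rewrite -lwhisker_comp assoc_nat_m lwhisker_comp.
by rewrite (post2 (counit_at_nat _)) -vcompA.
Qed.

Lemma absorb_nat_r (X Y : E) (g : E Y L) (f f' : E X Y) (α : f ⟹ f') :
  absorb g f' ∘ (l ◁ (r · g ◁ α)) = (g ◁ α) ∘ absorb g f.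
Proof.
rewrite /absorb; rassoc; rewrite -lwhisker_comp assoc_nat_r lwhisker_comp.
by rewrite (post2 (counit_at_nat _)) -vcompA.
Qed.

(** By naturality of the counit and the pentagon.  This is the part of the
    associativity axiom for [K] that is not inherited from [b]. *)
Lemma absorb_assoc (W X Y : E) (h : E Y L) (g : E X Y) (f : E W X) :
  absorb h (g · f) ∘ ((l ◁ assoc (r · h) g f) ∘ (l ◁ (bwd (assoc r h g) ▷ f)))
    = assoc h g f ∘ absorb (h · g) f.
Proof.
rewrite /absorb; rassoc; rewrite -!lwhisker_comp vcompA pentagon; rassoc.
rewrite rwhisker_fwdK vcomp_idr lwhisker_comp (post2 (counit_at_nat _)).
by rassoc.
Qed.

(** As the counit is compatible with precomposition, it can act on [g] alone,
    which is how it occurs in the axioms of a colax structure on [l]. *)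
Lemma absorb_counit (X Y : E) (g : E Y L) (f : E X Y) :
  absorb g f = (counit_at ε g ▷ f) ∘ bwd (assoc l (r · g) f).
Proof.
by rewrite counit_at_rwhisker; rassoc; rewrite fwdK vcomp_idr.
Qed.

Lemma absorb_bwd (X Y : E) (g : E Y L) (f : E X Y) :
  absorb g f ∘ (l ◁ bwd (assoc r g f)) = counit_at ε (g · f).
Proof. by rewrite /absorb -vcompA lwhisker_fwdK vcomp_idr. Qed.

End Adjunction.

(** * The pseudoalgebra structure on the left object *)

Section Transfer.

Context {A E : Bicategory} {J : Pseudofunctor A E} (T : RelPseudomonad J)
  {K L : E} {l : E K L} {r : E L K} {ν : id1 K ⟹ r · l} {ε : l · r ⟹ id1 L}
  (adj : IsAdjunction ν ε) (b : PsAlgStr T L).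

Definition transfer_ext (X : A) : Functor (E (J X) K) (E (T X) K).
Proof.
refine {| fobj f := r · aext b (l · f);
          fmap f f' α := r ◁ fmap (aext b) (l ◁ α) |}.
- by move=> f; rewrite lwhisker_id fmap_id lwhisker_id.
- by move=> f f' f'' β α; rewrite !(lwhisker_comp, fmap_comp).
Defined.

Definition transfer_hat (X Y : A) (g : E (J Y) K) (f : E (J X) (T Y)) :
    transfer_ext X (transfer_ext Y g · f) ⟹ transfer_ext Y g · ext T f :=
  bwd (assoc r (aext b (l · g)) (ext T f))
    ∘ (r ◁ (ahat b (l · g) f ∘ fmap (aext b) (absorb ε (aext b (l · g)) f))).

Definition transfer_tilde (X : A) (f : E (J X) K) :
    f ⟹ transfer_ext X f · Ti T X :=
  bwd (assoc r (aext b (l · f)) (Ti T X)) ∘ (r ◁ atilde b (l · f))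
    ∘ unit_at ν f.

Lemma transfer_hat_nat_r (X Y : A) (g : E (J Y) K) (f f' : E (J X) (T Y))
    (α : f ⟹ f') :
  transfer_hat g f' ∘ fmap (transfer_ext X) (transfer_ext Y g ◁ α)
    = (transfer_ext Y g ◁ fmap (ext T) α) ∘ transfer_hat g f.
Proof.
rewrite /transfer_hat /=; rassoc.
rewrite (post2 (assoc_inv_nat_r _ _ _)); rassoc.
congr (_ ∘ _); rewrite -!lwhisker_comp; congr (_ ◁ _).
by rewrite -vcompA -fmap_comp absorb_nat_r fmap_comp !vcompA ahat_nat_r.
Qed.

Lemma transfer_hat_nat_l (X Y : A) (g g' : E (J Y) K) (f : E (J X) (T Y))
    (β : g ⟹ g') :
  transfer_hat g' f ∘ fmap (transfer_ext X) (fmap (transfer_ext Y) β ▷ f)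
    = (fmap (transfer_ext Y) β ▷ ext T f) ∘ transfer_hat g f.
Proof.
rewrite /transfer_hat /=; rassoc.
rewrite (post2 (assoc_inv_nat_m _ _ _)); rassoc.
congr (_ ∘ _); rewrite -!lwhisker_comp; congr (_ ◁ _).
by rewrite -vcompA -fmap_comp absorb_nat_l fmap_comp !vcompA ahat_nat_l.
Qed.

Lemma transfer_tilde_nat (X : A) (f f' : E (J X) K) (α : f ⟹ f') :
  transfer_tilde f' ∘ α
    = (fmap (transfer_ext X) α ▷ Ti T X) ∘ transfer_tilde f.
Proof.
rewrite /transfer_tilde /=; rassoc; rewrite unit_at_nat.
rewrite (post2 (assoc_inv_nat_m _ _ _)) -!vcompA; congr (_ ∘ _).
by rewrite !vcompA -!lwhisker_comp atilde_nat.
Qed.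

(** After the counit of the outer extension is pushed inwards by naturality,
    the outer part is associativity for [b], and what is left inside
    [(-)^b] is [absorb_assoc]. *)
Lemma transfer_assoc (X Y Z : A) (h : E (J Z) K) (g : E (J Y) (T Z))
    (f : E (J X) (T Y)) :
  assoc (transfer_ext Z h) (ext T g) (ext T f)
      ∘ (transfer_hat h g ▷ ext T f) ∘ transfer_hat (transfer_ext Z h · g) f
    = (transfer_ext Z h ◁ Tmu T g f) ∘ transfer_hat h (ext T g · f)
      ∘ fmap (transfer_ext X) (assoc (transfer_ext Z h) (ext T g) f)
      ∘ fmap (transfer_ext X) (transfer_hat h g ▷ f).
Proof.
rewrite /transfer_hat /= !rwhisker_comp; rassoc.
rewrite (post2 (assoc_inv_nat_r _ _ _)) (post2 (assoc_inv_nat_m _ _ _)); rassoc.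
have P : assoc (r · aext b (l · h)) (ext T g) (ext T f)
    ∘ ((bwd (assoc r (aext b (l · h)) (ext T g)) ▷ ext T f)
       ∘ bwd (assoc r (aext b (l · h) · ext T g) (ext T f)))
  = bwd (assoc r (aext b (l · h)) (ext T g · ext T f))
    ∘ (r ◁ assoc (aext b (l · h)) (ext T g) (ext T f)).
  by rewrite vcompA -pentagon_bwd; rassoc; rewrite fwdK vcomp_idr.
rewrite (post3 P) -!vcompA; congr (_ ∘ _); rewrite -!lwhisker_comp.
congr (_ ◁ _); rewrite !rwhisker_comp; rassoc.
rewrite (post2 (eq_sym (ahat_nat_l _ _ _))); rassoc.
have := ahat_assoc b (l · h) g f; rewrite -!vcompA => Hb.
rewrite (post3 Hb) -!vcompA; congr (_ ∘ (_ ∘ _)); rewrite -!fmap_comp.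
congr (fmap _ _).
rewrite -absorb_nat_l (post2 (eq_sym (absorb_nat_l _ _ _))); rassoc.
rewrite !(lwhisker_comp, rwhisker_comp) (post3 (absorb_assoc _ _ _ _)).
by rassoc.
Qed.

(** The counit in [transfer_hat] meets the unit in [transfer_tilde] and both
    disappear by a triangle identity, leaving the unit axiom of [b]. *)
Lemma transfer_unit (X : A) (f : E (J X) K) :
  (transfer_ext X f ◁ Ttheta T X) ∘ transfer_hat f (Ti T X)
      ∘ fmap (transfer_ext X) (transfer_tilde f)
    = bwd (runit (transfer_ext X f)).
Proof.
rewrite /transfer_hat /transfer_tilde /=; rassoc.
rewrite (post2 (assoc_inv_nat_r _ _ _)); rassoc; rewrite -!lwhisker_comp -vcompA.
rewrite -fmap_comp [l ◁ _]lwhisker_comp (post2 (absorb_bwd _ _ _)).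
rewrite (counit_at_transpose adj).
have := ahat_unit b (l · f); rewrite -!vcompA => ->.
apply: (fwd_inj_l (i := runit _)); rewrite fwdK -runit_comp -vcompA fwdKk.
exact: lwhisker_fwdK.
Qed.

Lemma comparison_nat (X : A) (f f' : E (J X) L) (α : f ⟹ f') :
  comparison b ε f' ∘ (r ◁ fmap (aext b) (l ◁ (r ◁ α)))
    = (r ◁ fmap (aext b) α) ∘ comparison b ε f.
Proof.
by rewrite /comparison -!lwhisker_comp -!fmap_comp counit_at_nat.
Qed.

Hypothesis ν_iso : is_iso ν.
Hypothesis comparison_iso :
  forall (X : A) (f : E (J X) L), is_iso (comparison b ε f).

(** Up to invertible constraints, [transfer_hat g f] is the comparison at
    [(l·g)^b · f]. *)
Lemma transfer_hat_iso (X Y : A) (g : E (J Y) K) (f : E (J X) (T Y)) :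
  is_iso (transfer_hat g f).
Proof.
apply: is_iso_comp; first exact: is_iso_bwd.
rewrite lwhisker_comp; apply: is_iso_comp.
  exact/is_iso_lwhisker/ahat_iso.
rewrite fmap_comp lwhisker_comp; apply: is_iso_comp; first exact: comparison_iso.
exact/is_iso_lwhisker/is_iso_fmap/is_iso_lwhisker/is_iso_fwd.
Qed.

Lemma transfer_tilde_iso (X : A) (f : E (J X) K) : is_iso (transfer_tilde f).
Proof.
apply: is_iso_comp; last exact: is_iso_unit_at.
apply: is_iso_comp; first exact: is_iso_bwd.
exact/is_iso_lwhisker/atilde_iso.
Qed.

Definition transfer : PsAlgStr T K :=
  Build_PsAlgStr transfer_hat_iso transfer_tilde_iso transfer_hat_nat_r
    transfer_hat_nat_l transfer_tilde_nat transfer_assoc transfer_unit.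

(** * The morphism structures on the two adjoints *)

Definition left_bar (X : A) (f : E (J X) K) :
    l · aext transfer f ⟹ aext b (l · f) :=
  counit_at ε (aext b (l · f)).

Lemma left_bar_nat (X : A) (f f' : E (J X) K) (α : f ⟹ f') :
  left_bar f' ∘ (l ◁ fmap (aext transfer) α)
    = fmap (aext b) (l ◁ α) ∘ left_bar f.
Proof. exact: counit_at_nat. Qed.

Lemma left_bar_hat (X Y : A) (g : E (J Y) K) (f : E (J X) (T Y)) :
  ahat b (l · g) f ∘ fmap (aext b) (left_bar g ▷ f)
      ∘ fmap (aext b) (bwd (assoc l (aext transfer g) f))
      ∘ left_bar (aext transfer g · f)
    = (left_bar g ▷ ext T f) ∘ bwd (assoc l (aext transfer g) (ext T f))
      ∘ (l ◁ ahat transfer g f).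
Proof.
rewrite /left_bar /= /transfer_hat -absorb_counit.
rewrite lwhisker_comp (post2 (absorb_bwd _ _ _)) counit_at_nat absorb_counit.
by rewrite fmap_comp !vcompA.
Qed.

Lemma left_bar_tilde (X : A) (f : E (J X) K) :
  (left_bar f ▷ Ti T X) ∘ bwd (assoc l (aext transfer f) (Ti T X))
      ∘ (l ◁ atilde transfer f)
    = atilde b (l · f).
Proof.
rewrite /left_bar /= /transfer_tilde -absorb_counit.
rassoc; rewrite lwhisker_comp (post2 (absorb_bwd _ _ _)).
exact: counit_at_transpose.
Qed.

Definition left_colax : ColaxStr transfer b l :=
  Build_ColaxStr left_bar_nat left_bar_hat left_bar_tilde.

Definition comparison_Iso (X : A) (f : E (J X) L) :=
  iso_of (comparison_iso f).

Definition right_bar (X : A) (f : E (J X) L) :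
    r · aext b f ⟹ aext transfer (r · f) :=
  bwd (comparison_Iso f).

Lemma fwd_comparison_Iso (X : A) (f : E (J X) L) :
  fwd (comparison_Iso f) = comparison b ε f.
Proof. exact: fwd_iso_of. Qed.

Lemma right_barK (X : A) (f : E (J X) L) :
  comparison b ε f ∘ right_bar f = idm (r · aext b f).
Proof. by rewrite -fwd_comparison_Iso; apply: fwdK. Qed.

Lemma right_bar_nat (X : A) (f f' : E (J X) L) (α : f ⟹ f') :
  right_bar f' ∘ (r ◁ fmap (aext b) α)
    = fmap (aext transfer) (r ◁ α) ∘ right_bar f.
Proof.
apply/eq_sym/square_inv; rewrite !fwd_comparison_Iso; exact: comparison_nat.
Qed.

(** The multiplication axiom for [r], stated for the comparison itself so that
    no inverse occurs; [right_bar_hat] follows by inverting. *)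
Lemma comparison_hat (X Y : A) (g : E (J Y) L) (f : E (J X) (T Y)) :
  (comparison b ε g ▷ ext T f) ∘ ahat transfer (r · g) f
    = bwd (assoc r (aext b g) (ext T f)) ∘ (r ◁ ahat b g f)
      ∘ comparison b ε (aext b g · f)
      ∘ fmap (aext transfer) (assoc r (aext b g) f)
      ∘ fmap (aext transfer) (comparison b ε g ▷ f).
Proof.
rewrite /= /transfer_hat /comparison; rassoc.
rewrite (post2 (assoc_inv_nat_m _ _ _)) -!vcompA; congr (_ ∘ _).
rewrite -!lwhisker_comp; congr (_ ◁ _).
rewrite vcompA -ahat_nat_l -!vcompA -!fmap_comp; congr (_ ∘ fmap _ _).
by rewrite -absorb_nat_l /absorb -vcompA.
Qed.

Lemma right_bar_hat (X Y : A) (g : E (J Y) L) (f : E (J X) (T Y)) :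
  ahat transfer (r · g) f ∘ fmap (aext transfer) (right_bar g ▷ f)
      ∘ fmap (aext transfer) (bwd (assoc r (aext b g) f))
      ∘ right_bar (aext b g · f)
    = (right_bar g ▷ ext T f) ∘ bwd (assoc r (aext b g) (ext T f))
      ∘ (r ◁ ahat b g f).
Proof.
rewrite -[LHS]vcomp_idl -(rwhisker_bwdK (comparison_Iso g)) fwd_comparison_Iso.
rassoc; rewrite -/(right_bar g); congr (_ ∘ _).
rewrite (post2 (comparison_hat _ _)); rassoc; congr (_ ∘ _).
rewrite -[RHS]vcomp_idr -(right_barK (aext b g · f)); congr (_ ∘ (_ ∘ _)).
rewrite !(post2 (eq_sym (fmap_comp _ _ _))); rassoc.
rewrite (post2 (eq_sym (rwhisker_comp _ _ _))) right_barK rwhisker_id vcomp_idl.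
by rewrite fwdK fmap_id vcomp_idl.
Qed.

Lemma right_bar_tilde (X : A) (f : E (J X) L) :
  (right_bar f ▷ Ti T X) ∘ bwd (assoc r (aext b f) (Ti T X))
      ∘ (r ◁ atilde b f)
    = atilde transfer (r · f).
Proof.
rewrite -[RHS]vcomp_idl -(rwhisker_bwdK (comparison_Iso f)) fwd_comparison_Iso.
rassoc; rewrite -/(right_bar f); congr (_ ∘ _).
rewrite /= /transfer_tilde /comparison; rassoc.
rewrite (post2 (assoc_inv_nat_m _ _ _)) -!vcompA; congr (_ ∘ _).
rewrite (post2 (eq_sym (lwhisker_comp _ _ _))) -atilde_nat lwhisker_comp -vcompA.
by rewrite (unit_counit_at adj) vcomp_idr.
Qed.

Definition right_colax : ColaxStr b transfer r :=
  Build_ColaxStr right_bar_nat right_bar_hat right_bar_tilde.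

Lemma right_colax_pseudo : IsPseudo right_colax.
Proof. by move=> X f; apply: is_iso_bwd. Qed.

Lemma left_colax_pseudo : is_iso ε -> IsPseudo left_colax.
Proof. by move=> i X f; apply: is_iso_counit_at. Qed.

(** * The unit and counit are transformations *)

Lemma unit_transf :
  IsTransformation (colax_id transfer) (colax_comp right_colax left_colax) ν.
Proof.
move=> X f.
rewrite [bar (colax_id _) f]/= /colax_id_bar.
rewrite [bar (colax_comp _ _) f]/= /colax_comp_bar.
have Hν (Y : E) (k : E Y K) :
    ν ▷ k = bwd (assoc r l k) ∘ unit_at ν k ∘ lunit k.
  by rewrite /unit_at -!vcompA bwdKk bwdK vcomp_idr.
rewrite !Hν 2!fmap_comp; rassoc; congr (_ ∘ _).
rewrite !(post2 (eq_sym (fmap_comp _ _ _))); rassoc; rewrite fwdK vcomp_idr fwdKk.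
lassoc; congr (_ ∘ _).
apply: (fwd_inj_l (i := comparison_Iso (l · f))).
rewrite fwd_comparison_Iso; rassoc; rewrite (post2 (right_barK _)) vcomp_idl.
rewrite (unit_counit_at adj) /comparison /= -lwhisker_comp -fmap_comp.
by rewrite (counit_unit_at adj) fmap_id lwhisker_id.
Qed.

Lemma counit_transf :
  IsTransformation (colax_comp left_colax right_colax) (colax_id b) ε.
Proof.
move=> X f.
rewrite [bar (colax_id _) f]/= /colax_id_bar.
rewrite [bar (colax_comp _ _) f]/= /colax_comp_bar.
have Hε (Y : E) (k : E Y L) :
    ε ▷ k = bwd (lunit k) ∘ counit_at ε k ∘ assoc l r k.
  by rewrite /counit_at -!vcompA bwdK vcomp_idr bwdKk.
rewrite !Hε 2!fmap_comp; rassoc; congr (_ ∘ _).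
rewrite !(post2 (eq_sym (fmap_comp _ _ _))); rassoc; rewrite fwdK vcomp_idr fwdKk.
lassoc; congr (_ ∘ _).
rewrite -counit_at_nat; rassoc; rewrite -lwhisker_comp.
by rewrite -/(comparison b ε f) right_barK lwhisker_id vcomp_idr.
Qed.

End Transfer.

(** * Lifts in terms of transformations *)

(** The 2-cells of [PsAlgc T] are 2-cells of [E] with a property, so the
    triangle identities need no new verification. *)
Lemma lift_to_PsAlgc (A E : Bicategory) (J : Pseudofunctor A E)
    (T : RelPseudomonad J) (K L : E) (l : E K L) (r : E L K)
    (ν : id1 K ⟹ r · l) (ε : l · r ⟹ id1 L) (a : PsAlgStr T K)
    (b : PsAlgStr T L) (sl : ColaxStr a b l) (sr : ColaxStr b a r) :
  IsAdjunction ν ε ->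
  IsTransformation (colax_id a) (colax_comp sr sl) ν ->
  IsTransformation (colax_comp sl sr) (colax_id b) ε ->
  LiftsToPsAlgc ν ε sl sr.
Proof.
move=> [tl tr] tν tε; exists tν, tε; split; apply: transf_eq.
- exact: tl.
- exact: tr.
Qed.

Lemma lift_to_PsAlg (A E : Bicategory) (J : Pseudofunctor A E)
    (T : RelPseudomonad J) (K L : E) (l : E K L) (r : E L K)
    (ν : id1 K ⟹ r · l) (ε : l · r ⟹ id1 L) (a : PsAlgStr T K)
    (b : PsAlgStr T L) (sl : ColaxStr a b l) (sr : ColaxStr b a r) :
  IsPseudo sl -> IsPseudo sr -> LiftsToPsAlgc ν ε sl sr ->
  LiftsToPsAlg ν ε sl sr.
Proof.
by move=> pl pr [tν [tε [tl tr]]]; exists pl, pr, tν, tε; split.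
Qed.

(** * Invertibility of the comparison for a lifted adjunction *)

Section Converse.

Context {A E : Bicategory} {J : Pseudofunctor A E} {T : RelPseudomonad J}
  {K L : E} {l : E K L} {r : E L K} {ν : id1 K ⟹ r · l} {ε : l · r ⟹ id1 L}
  {a : PsAlgStr T K} {b : PsAlgStr T L} {sl : ColaxStr a b l}
  {sr : ColaxStr b a r}.

(** The transformation axiom for [ν] with the associators and unitors absorbed
    into [unit_at]; [counit_transf_at] does the same for [ε]. *)
Lemma unit_transf_at :
  IsTransformation (colax_id a) (colax_comp sr sl) ν ->
  forall (X : A) (f : E (J X) K),
    bar sr (l · f) ∘ ((r ◁ bar sl f) ∘ unit_at ν (aext a f))
      = fmap (aext a) (unit_at ν f).
Proof.
move=> tν X f; have := tν X f.
rewrite [bar (colax_id _) f]/= /colax_id_bar.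
rewrite [bar (colax_comp _ _) f]/= /colax_comp_bar -!vcompA => H.
apply: (fwd_inj_r (i := lunit (aext a f))).
rewrite /unit_at -!vcompA bwdK vcomp_idr !fmap_comp -!vcompA H.
by rewrite (post2 (eq_sym (fmap_comp _ _ _))) fwdK fmap_id vcomp_idl.
Qed.

Lemma counit_transf_at :
  IsTransformation (colax_comp sl sr) (colax_id b) ε ->
  forall (X : A) (f : E (J X) L),
    fmap (aext b) (counit_at ε f) ∘ (bar sl (r · f) ∘ (l ◁ bar sr f))
      = counit_at ε (aext b f).
Proof.
move=> tε X f; have := tε X f.
rewrite [bar (colax_id _) f]/= /colax_id_bar.
rewrite [bar (colax_comp _ _) f]/= /colax_comp_bar -!vcompA => H.
apply: (fwd_inj_r (i := assoc l r (aext b f))).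
rewrite /counit_at !fmap_comp -!vcompA bwdK vcomp_idr H.
by rewrite (post2 (eq_sym (fmap_comp _ _ _))) fwdK fmap_id vcomp_idl.
Qed.

Hypothesis adj : IsAdjunction ν ε.
Hypothesis tν : IsTransformation (colax_id a) (colax_comp sr sl) ν.
Hypothesis tε : IsTransformation (colax_comp sl sr) (colax_id b) ε.

Definition mate (X : A) (g : E (J X) K) :
    aext a g ⟹ r · aext b (l · g) :=
  (r ◁ bar sl g) ∘ unit_at ν (aext a g).

(** Naturality of the structure of [r] moves the comparison to the other side,
    where the transformation axiom for [ν] leaves a triangle identity inside
    [(-)^a]. *)
Lemma right_bar_mate (X : A) (f : E (J X) L) :
  bar sr f ∘ (comparison b ε f ∘ mate (r · f)) = idm (aext a (r · f)).
Proof.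
rewrite vcompA /comparison bar_nat; rassoc; rewrite unit_transf_at //.
by rewrite -fmap_comp (unit_counit_at adj) fmap_id.
Qed.

(** Dual to [right_bar_mate], with the transformation axiom for [ε] and
    naturality of the unit. *)
Lemma mate_right_bar (X : A) (f : E (J X) L) :
  comparison b ε f ∘ mate (r · f) ∘ bar sr f = idm (r · aext b f).
Proof.
rewrite /mate; rassoc; rewrite unit_at_nat /comparison.
lassoc; rewrite -!lwhisker_comp; rassoc.
by rewrite counit_transf_at // (unit_counit_at adj).
Qed.

Lemma right_bar_iso (X : A) (f : E (J X) L) : is_iso (bar sr f).
Proof.
exists (comparison b ε f ∘ mate (r · f)); split.
- exact: mate_right_bar.
- exact: right_bar_mate.
Qed.

Lemma comparison_iso_of_lift :
  is_iso ν -> forall (X : A) (f : E (J X) L), is_iso (comparison b ε f).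
Proof.
(* The first goal is invertibility of the mate, the second that of the
   comparison after the mate. *)
move=> ν_iso X f; apply: (@is_iso_cancel_r _ _ _ _ _ (mate (r · f))).
  apply: is_iso_cancel_l (right_bar_iso _) _; rewrite unit_transf_at //.
  exact/is_iso_fmap/is_iso_unit_at.
apply: is_iso_cancel_l (right_bar_iso f) _; rewrite right_bar_mate.
exact: is_iso_id.
Qed.

End Converse.

Theorem corollary4p4 (A E : Bicategory) (J : Pseudofunctor A E)
    (T : RelPseudomonad J) (K L : E) (l : E K L) (r : E L K)
    (ν : id1 K ⟹ r · l) (ε : l · r ⟹ id1 L)
    (adj : IsAdjunction ν ε) (coreflective : is_iso ν) (b : PsAlgStr T L) :
  ((forall (X : A) (f : E (J X) L), is_iso (comparison b ε f)) ->
     exists (a : PsAlgStr T K) (sl : ColaxStr a b l) (sr : ColaxStr b a r),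
       IsPseudo sr /\ LiftsToPsAlgc ν ε sl sr)
  /\
  (is_iso ε ->
     exists (a : PsAlgStr T K) (sl : ColaxStr a b l) (sr : ColaxStr b a r),
       LiftsToPsAlg ν ε sl sr)
  /\
  ((exists (a : PsAlgStr T K) (sl : ColaxStr a b l) (sr : ColaxStr b a r),
      LiftsToPsAlgc ν ε sl sr) ->
   forall (X : A) (f : E (J X) L), is_iso (comparison b ε f)).
Proof.
have lift c := lift_to_PsAlgc adj (unit_transf adj coreflective c)
  (counit_transf adj coreflective c).
split; [|split].
- move=> c; exists (transfer adj coreflective c), (left_colax adj coreflective c),
    (right_colax adj coreflective c).
  by split; [exact: right_colax_pseudo | exact: lift].
- move=> ε_iso.
  have c (X : A) (f : E (J X) L) : is_iso (comparison b ε f).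
    exact/is_iso_lwhisker/is_iso_fmap/is_iso_counit_at.
  exists (transfer adj coreflective c), (left_colax adj coreflective c),
    (right_colax adj coreflective c).
  apply: lift_to_PsAlg; [exact: left_colax_pseudo | exact: right_colax_pseudo |].
  exact: lift.
- move=> [a [sl [sr [tν [tε _]]]]].
  exact: comparison_iso_of_lift adj tν tε coreflective.
Qed.
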